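(* In the horizontal model, the length generating function $W(t)$ of weakly directed bridges is $$ W(t)=\frac{1}{1+t-\dfrac{2tB}{1+tB}}, $$ where $B:=\sum_{k\ge 0}B^{(k)}(t)$ is the length generating function of NES-pseudo-bridges.
   Context: The square lattice steps are N$=(0,1)$, E$=(1,0)$, S$=(0,-1)$, W$=(-1,0)$. All walks $v_0,\dots,v_n$ on $\mathbb{Z}^2$ are self-avoiding and counted up to translation; the empty walk (length $0$) is allowed. The length generating function of a class of walks is $\sum_w t^{|w|}$, $|w|$ being the number of steps. For a set $\mathcal S$ of steps, an $\mathcal S$-walk is a self-avoiding walk with all steps in $\mathcal S$. Horizontal model: the height $h(v)$ of a vertex is its ordinate. A walk is weakly directed if whenever $i<j$ and $h(v_i)=h(v_j)$, the portion $v_i,\dots,v_j$ avoids at least one of the steps N, E, S, W. A walk is a bridge if all its vertices $v\ne v_n$ satisfy $h(v_0)\le h(v)<h(v_n)$, and a pseudo-bridge if all its vertices satisfy $h(v_0)\le h(v)\le h(v_n)$; the height of a pseudo-bridge is $h(v_n)-h(v_0)$. $B^{(k)}(t)$ is the length generating function of NES-pseudo-bridges of height $k$; explicitly, $B^{(k)}(t)=t^k/G_k(t)$ where $G_{-1}=1$, $G_0=1-t$ and $G_{k+1}=(1-t+t^2+t^3)G_k-t^2G_{k-1}$ for $k\ge0$. *)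

(* Defs.v *)
From HB Require Import structures.
From mathcomp Require Import all_boot all_order all_algebra.
From mathcomp Require Import boolp.

Set Implicit Arguments.
Unset Strict Implicit.
Unset Printing Implicit Defensive.

Import Order.TTheory GRing.Theory Num.Theory.
Local Open Scope ring_scope.

(* Formal power series over R, as a ring with units. As usual in MathComp,   *)
(* x^-1 = x when x is not a unit; a series is a unit iff its constant        *)
(* coefficient is a unit of R.                                               *)

Record fps (R : Type) := Fps { fcoef : nat -> R }.

Lemma fpsP (R : Type) (f g : fps R) : (forall n, fcoef f n = fcoef g n) <-> f = g.
Proof.
split=> [|-> //]; case: f => f; case: g => g /= fg.
by congr Fps; apply: funext.
Qed.

HB.instance Definition _ (R : Type) := gen_eqMixin (fps R).
HB.instance Definition _ (R : Type) := gen_choiceMixin (fps R).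

Section FpsZmod.
Variable R : zmodType.
Implicit Types f g h : fps R.

Definition fps_zero : fps R := Fps (fun=> 0).
Definition fps_opp f : fps R := Fps (fun n => - fcoef f n).
Definition fps_add f g : fps R := Fps (fun n => fcoef f n + fcoef g n).

Fact fps_addA : associative fps_add.
Proof. by move=> f g h; apply/fpsP => n /=; rewrite addrA. Qed.
Fact fps_addC : commutative fps_add.
Proof. by move=> f g; apply/fpsP => n /=; rewrite addrC. Qed.
Fact fps_add0 : left_id fps_zero fps_add.
Proof. by move=> f; apply/fpsP => n /=; rewrite add0r. Qed.
Fact fps_addN : left_inverse fps_zero fps_opp fps_add.
Proof. by move=> f; apply/fpsP => n /=; rewrite addNr. Qed.

HB.instance Definition _ :=
  GRing.isZmodule.Build (fps R) fps_addA fps_addC fps_add0 fps_addN.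

Lemma fcoef0 n : fcoef (0 : fps R) n = 0. Proof. by []. Qed.
Lemma fcoefD f g n : fcoef (f + g) n = fcoef f n + fcoef g n. Proof. by []. Qed.
Lemma fcoefN f n : fcoef (- f) n = - fcoef f n. Proof. by []. Qed.
Lemma fcoef_sum (I : Type) (r : seq I) (P : pred I) (F : I -> fps R) n :
  fcoef (\sum_(i <- r | P i) F i) n = \sum_(i <- r | P i) fcoef (F i) n.
Proof. by apply: (big_morph (fun f => fcoef f n)). Qed.

End FpsZmod.

Section FpsRing.
Variable R : comNzRingType.
Implicit Types f g h : fps R.

Definition fps_one : fps R := Fps (fun n => (n == 0%N)%:R).
Definition fps_mul f g : fps R :=
  Fps (fun n => \sum_(i < n.+1) fcoef f i * fcoef g (n - i)).

(* Ring laws are transferred from {poly R} by truncation. *)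
Let agree n (p : {poly R}) f := forall i, (i <= n)%N -> p`_i = fcoef f i.
Let trunc n f : {poly R} := \poly_(i < n.+1) fcoef f i.

Let agree_trunc n f : agree n (trunc n f) f.
Proof. by move=> i le_in; rewrite coef_poly ltnS le_in. Qed.

Let agree_mul n p q f g :
  agree n p f -> agree n q g -> agree n (p * q) (fps_mul f g).
Proof.
move=> pf qg i le_in; rewrite coefM /=; apply: eq_bigr => j _.
have le_ji : (j <= i)%N by rewrite -ltnS.
by rewrite pf ?(leq_trans le_ji) // qg // (leq_trans (leq_subr _ _)).
Qed.

Fact fps_mulA : associative fps_mul.
Proof.
move=> f g h; apply/fpsP => n.
have Tf := @agree_trunc n f; have Tg := @agree_trunc n g.
have Th := @agree_trunc n h.
rewrite -(agree_mul Tf (agree_mul Tg Th)) // mulrA.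
by rewrite (agree_mul (agree_mul Tf Tg) Th).
Qed.

Fact fps_mulC : commutative fps_mul.
Proof.
move=> f g; apply/fpsP => n.
have Tf := @agree_trunc n f; have Tg := @agree_trunc n g.
by rewrite -(agree_mul Tf Tg) // mulrC (agree_mul Tg Tf).
Qed.

Fact fps_mul1 : left_id fps_one fps_mul.
Proof.
move=> f; apply/fpsP => n /=.
by rewrite big_ord_recl /= mul1r subn0 big1 ?addr0 // => i _; rewrite mul0r.
Qed.

Fact fps_mulDl : left_distributive fps_mul (@fps_add R).
Proof.
move=> f g h; apply/fpsP => n /=; rewrite -big_split.
by apply: eq_bigr => i _; rewrite mulrDl.
Qed.

Fact fps_one_neq0 : fps_one != 0.
Proof.
apply/eqP => /fpsP/(_ 0%N)/eqP.
by rewrite fcoef0 /= oner_eq0.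
Qed.

HB.instance Definition _ := GRing.Zmodule_isComNzRing.Build (fps R)
  fps_mulA fps_mulC fps_mul1 fps_mulDl fps_one_neq0.

Lemma fcoef1 n : fcoef (1 : fps R) n = (n == 0%N)%:R. Proof. by []. Qed.
Lemma fcoefM f g n :
  fcoef (f * g) n = \sum_(i < n.+1) fcoef f i * fcoef g (n - i).
Proof. by []. Qed.

Definition fpsX : fps R := Fps (fun n => (n == 1%N)%:R).

End FpsRing.

Section FpsUnit.
Variable R : comUnitRingType.
Implicit Types f g h : fps R.

Definition fps_unit : pred (fps R) := fun f => fcoef f 0 \is a GRing.unit.

(* [:: g_n; ...; g_0], where g is the inverse of f: g_0 = f_0^-1 and         *)
(* g_n = - f_0^-1 * \sum_(i < n) f_(i+1) * g_(n-1-i).                        *)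
Fixpoint fps_inv_seq f (n : nat) : seq R :=
  if n is m.+1 then
    let s := fps_inv_seq f m in
    - ((fcoef f 0)^-1 * \sum_(i < n) fcoef f i.+1 * s`_i) :: s
  else [:: (fcoef f 0)^-1].

Definition fps_inv f : fps R :=
  if fps_unit f then Fps (fun n => (fps_inv_seq f n)`_0) else f.

Let nth_inv_seq f n i :
  (i <= n)%N -> (fps_inv_seq f n)`_i = (fps_inv_seq f (n - i))`_0.
Proof.
elim: n i => [|n IHn] [|i] //= le_in.
by rewrite subSS IHn.
Qed.

Fact fps_mulVr : {in fps_unit, left_inverse 1 fps_inv *%R}.
Proof.
move=> f fU; have Uf : fps_unit f by [].
have Uf0 : fcoef f 0 \is a GRing.unit by [].
rewrite mulrC; apply/fpsP => -[|n]; rewrite /fps_inv Uf fcoefM fcoef1.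
  by rewrite big_ord1 /= divrr.
rewrite big_ord_recl subn0 /= mulrN mulrA divrr // mul1r.
apply/eqP; rewrite addrC subr_eq0; apply/eqP; apply: eq_bigr => i _ /=.
by rewrite subSS (@nth_inv_seq f n i) // -ltnS ltn_ord.
Qed.

Fact fps_unitP f g : g * f = 1 -> fps_unit f.
Proof.
move=> /fpsP/(_ 0%N); rewrite fcoefM big_ord1 fcoef1 /= => gf1.
by apply/unitrPr; exists (fcoef g 0); rewrite mulrC.
Qed.

Fact fps_inv_out : {in [predC fps_unit], fps_inv =1 id}.
Proof. by move=> f nUf; rewrite /fps_inv ifN. Qed.

HB.instance Definition _ := GRing.ComNzRing_hasMulInverse.Build (fps R)
  fps_mulVr fps_unitP fps_inv_out.

Lemma unit_fpsE f : (f \is a GRing.unit) = (fcoef f 0 \is a GRing.unit).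
Proof. by []. Qed.

End FpsUnit.

(* S = \sum_(k >= 0) F k, coefficientwise (t-adically). *)
Definition fps_has_sum (R : zmodType) (F : nat -> fps R) (S : fps R) : Prop :=
  forall n, exists K, forall m, (K <= m)%N ->
    fcoef (\sum_(k < m) F k) n = fcoef S n.

Inductive step := North | East | South | West.

Definition step_code (s : step) : 'I_4 :=
  match s with
  | North => inord 0 | East => inord 1 | South => inord 2 | West => inord 3
  end.
Definition step_decode (i : 'I_4) : step := nth North [:: North; East; South; West] i.
Fact step_codeK : cancel step_code step_decode.
Proof. by case; rewrite /step_decode /= inordK. Qed.

HB.instance Definition _ := Countable.copy step (can_type step_codeK).
HB.instance Definition _ : isFinite step := CanIsFinite step_codeK.

Definition dir (s : step) : int * int :=
  match s with
  | North => (0, 1) | East => (1, 0) | South => (0, -1) | West => (-1, 0)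
  end.

(* A walk up to translation is its word of steps w; its representative       *)
(* starting at the origin has vertices [vertex w i], 0 <= i <= size w, and   *)
(* the portion from vertex i to vertex j has steps [drop i (take j w)].      *)
Definition vertex (w : seq step) (i : nat) : int * int :=
  \sum_(s <- take i w) dir s.

Definition height (v : int * int) : int := v.2.

Definition self_avoiding (w : seq step) : bool :=
  uniq [seq vertex w i | i <- iota 0 (size w).+1].

Definition swalk (A : {set step}) (w : seq step) : bool :=
  self_avoiding w && all [in A] w.

Definition NES : {set step} := [set North; East; South].

Definition weakly_directed (w : seq step) : bool :=
  self_avoiding w &&
  [forall i : 'I_(size w).+1, forall j : 'I_(size w).+1,
    (i < j)%N && (height (vertex w i) == height (vertex w j)) ==>
    [exists s : step, s \notin drop i (take j w)]].

Definition bridge (w : seq step) : bool :=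
  self_avoiding w &&
  [forall i : 'I_(size w).+1, (vertex w i != vertex w (size w)) ==>
    (height (vertex w 0) <= height (vertex w i) < height (vertex w (size w)))].

Definition pseudo_bridge (w : seq step) : bool :=
  self_avoiding w &&
  [forall i : 'I_(size w).+1,
    height (vertex w 0) <= height (vertex w i) <= height (vertex w (size w))].

Definition walk_height (w : seq step) : int :=
  height (vertex w (size w)) - height (vertex w 0).

Definition length_gf (C : pred (seq step)) : fps int :=
  Fps (fun n => #|[set w : n.-tuple step | C w]|%:Z).

Definition wd_bridge_gf : fps int :=
  length_gf (fun w => weakly_directed w && bridge w).

Definition NES_pb_gf : fps int :=
  length_gf (fun w => swalk NES w && pseudo_bridge w).

Definition NES_pb_height_gf (k : nat) : fps int :=
  length_gf (fun w => [&& swalk NES w, pseudo_bridge w & walk_height w == k%:Z]).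

(* Main.v *)
Require Import Defs.
From mathcomp Require Import all_boot all_order all_algebra.
From mathcomp Require Import zify ring.

Set Implicit Arguments.
Unset Strict Implicit.
Unset Printing Implicit Defensive.

Import Order.TTheory GRing.Theory Num.Theory.
Local Open Scope ring_scope.

(** A nonempty bridge factors uniquely as an irreducible bridge followed by a
    bridge ([bridge_first_factor], [irreducible_factor_size]), and vertices on
    either side of the junction of two bridges lie at different heights. So for
    each class P of walks defined bridge by bridge, such as the weakly directed
    walks or the NES-walks, the generating function F of the bridges in P
    satisfies F = 1 + I F, where I counts the irreducible bridges in P
    ([bridge_gf_irreducible]).

    An NES-bridge is empty, or an NES-pseudo-bridge followed by a North step, so
    F = 1 + tB for NES-bridges and their irreducible ones are counted by
    I = tB / (1 + tB).

    The heart of the matter is that an irreducible bridge is weakly directed if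
    and only if it avoids East or West ([irreducible_weakly_directed]). Suppose
    that a weakly directed bridge contains both. Between two opposite horizontal
    steps x and y that are consecutive among its horizontal steps, it runs
    straight North or South. A portion joining two vertices of equal height
    cannot contain both East and West; hence no height is attained both before x
    and after y. Heights vary by at most one at each step, so all heights before
    x are smaller than all heights after y. The run from x to y thus goes North,
    and cutting it where it first exceeds all heights before x splits the walk
    into two nonempty bridges: it is not irreducible.

    By reflection, NES and NWS irreducible bridges are equinumerous, and only
    the bridge reduced to one North step is of both kinds. Hence weakly directed
    irreducible bridges are counted by 2I - t, and W = 1 + (2I - t) W. *)

(** * Words of steps and their factorizations *)

Lemma cons_neq_nil (T : Type) (x : T) (w : seq T) : x :: w <> [::].
Proof. by []. Qed.

Lemma cat_eq_cat (T : Type) (a b c d : seq T) : a ++ b = c ++ d ->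
  (exists e, a = c ++ e /\ d = e ++ b) \/ (exists e, c = a ++ e /\ b = e ++ d).
Proof.
elim: a c => [|x a IHa] [|y c] /= E.
- by left; exists [::].
- by right; exists (y :: c).
- by left; exists (x :: a).
- case: E => -> /IHa[] [e [-> ->]]; [left | right]; by exists e.
Qed.

Lemma factorP (T : Type) (w u s v : seq T) : w = u ++ s ++ v ->
  drop (size u) (take (size u + size s) w) = s.
Proof. by move=> ->; rewrite catA -size_cat take_size_cat // drop_size_cat. Qed.

Lemma take_factor (T : Type) (w : seq T) i j : (i <= j)%N ->
  take j w = take i w ++ drop i (take j w).
Proof. by move=> le_ij; rewrite -{1}(cat_take_drop i (take j w)) take_takel. Qed.

Lemma factor_take_drop (T : Type) (w : seq T) i j : (i <= j)%N ->
  w = take i w ++ drop i (take j w) ++ drop j w.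
Proof. by move=> le_ij; rewrite catA -take_factor // cat_take_drop. Qed.

(** The displacement of a word: the vector from its start to its end. *)
Definition disp (w : seq step) : int * int := \sum_(s <- w) dir s.

(** The height gained along a word. *)
Definition rise (w : seq step) : int := (disp w).2.

Lemma disp_nil : disp [::] = 0. Proof. exact: big_nil. Qed.

Lemma disp_cons s w : disp (s :: w) = dir s + disp w.
Proof. exact: big_cons. Qed.

Lemma disp_cat u v : disp (u ++ v) = disp u + disp v.
Proof. exact: big_cat. Qed.

Lemma rise_nil : rise [::] = 0. Proof. by rewrite /rise disp_nil. Qed.

Lemma rise_cons s w : rise (s :: w) = (dir s).2 + rise w.
Proof. by rewrite /rise disp_cons. Qed.

Lemma rise_cat u v : rise (u ++ v) = rise u + rise v.
Proof. by rewrite /rise disp_cat. Qed.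

Definition riseE := (rise_cat, rise_cons, rise_nil).

Lemma rise_nseqN m : rise (nseq m North) = m%:Z.
Proof. by elim: m => [|m IHm]; rewrite /= riseE ?IHm //=; lia. Qed.

Lemma rise_nseqS m : rise (nseq m South) = - m%:Z.
Proof. by elim: m => [|m IHm]; rewrite /= riseE ?IHm //=; lia. Qed.

Lemma rise_size w : rise w <= (size w)%:Z.
Proof. by elim: w => [|[] w IHw]; rewrite riseE //=; lia. Qed.

Lemma disp_vertex w i : vertex w i = disp (take i w). Proof. by []. Qed.

Lemma height_vertex w i : height (vertex w i) = rise (take i w).
Proof. by []. Qed.

(** * The classes of walks, in terms of factorizations *)

(** A walk is self-avoiding when no nonempty factor has zero displacement. *)
Lemma self_avoidingP w :
  reflect (forall u s v, w = u ++ s ++ v -> s <> [::] -> disp s <> 0)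
          (self_avoiding w).
Proof.
rewrite /self_avoiding; apply: (iffP idP).
  move=> /uniqP-/(_ 0) Uw u s v Ew s0 d0.
  have := Uw (size u) (size u + size s)%N.
  have sw : size w = (size u + size s + size v)%N by rewrite Ew !size_cat addnA.
  rewrite !inE !size_map !size_iota !(nth_map 0%N) ?size_iota ?nth_iota ?sw;
    try lia.
  rewrite !add0n !disp_vertex Ew take_size_cat // catA -size_cat.
  rewrite take_size_cat //.
  rewrite disp_cat d0 addr0 size_cat => /(_ _ _ erefl) E.
  by apply: s0; apply: size0nil; lia.
move=> H; rewrite map_inj_in_uniq ?iota_uniq //.
suff Hlt i j : (i < j <= size w)%N -> vertex w i <> vertex w j.
  move=> i j; rewrite !mem_iota => Hi Hj E.
  by case: (ltngtP i j) => // lt; [case: (Hlt i j) | case: (Hlt j i)] => //; lia.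
case/andP=> lt_ij le_jw E.
have Ew := factor_take_drop w (ltnW lt_ij).
have Et := take_factor w (ltnW lt_ij).
apply: (H _ _ _ Ew).
  by move/(congr1 size); rewrite size_drop size_takel //=; lia.
move: E; rewrite !disp_vertex {1}Et disp_cat => /eqP.
by rewrite -subr_eq0 opprD addNKr oppr_eq0 => /eqP.
Qed.

Lemma weakly_directedP w :
  reflect (self_avoiding w /\ forall u s v, w = u ++ s ++ v -> rise s = 0 ->
             exists x, x \notin s)
          (weakly_directed w).
Proof.
apply: (iffP andP) => -[SA H]; split=> //.
  move=> u s v Ew r0; case: (posnP (size s)) => [/size0nil ->|s_gt0].
    by exists North.
  have sw : size w = (size u + size s + size v)%N by rewrite Ew !size_cat addnA.
  have lti : (size u < (size w).+1)%N by lia.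
  have ltj : (size u + size s < (size w).+1)%N by lia.
  move/forallP/(_ (Ordinal lti))/forallP/(_ (Ordinal ltj)): H => /=.
  rewrite !height_vertex (factorP Ew) Ew take_size_cat // catA -size_cat.
  rewrite take_size_cat // rise_cat r0 addr0 eqxx size_cat andbT.
  by rewrite -{1}(addn0 (size u)) ltn_add2l s_gt0 => /existsP.
apply/forallP=> i; apply/forallP=> j; apply/implyP=> /andP[lt_ij].
rewrite !height_vertex => /eqP E; apply/existsP.
apply: (H _ _ _ (factor_take_drop w (ltnW lt_ij))).
by move: E; rewrite {1}(take_factor w (ltnW lt_ij)) rise_cat; lia.
Qed.

Lemma prefix_forallP (P : seq step -> bool) w :
  (forall i : 'I_(size w).+1, P (take i w)) <->
  (forall u v, w = u ++ v -> P u).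
Proof.
split=> H.
  move=> u v Ew; have lti : (size u < (size w).+1)%N by rewrite Ew size_cat; lia.
  by have := H (Ordinal lti); rewrite /= Ew take_size_cat.
by move=> i; apply: (H _ (drop i w)); rewrite cat_take_drop.
Qed.

Lemma pseudo_bridgeP w :
  reflect (self_avoiding w /\ forall u v, w = u ++ v -> 0 <= rise u <= rise w)
          (pseudo_bridge w).
Proof.
have E : (forall i : 'I_(size w).+1, 0 <= rise (take i w) <= rise w) <->
         (forall u v, w = u ++ v -> 0 <= rise u <= rise w).
  exact: (prefix_forallP (fun u => 0 <= rise u <= rise w)).
apply: (iffP andP) => -[SA H]; split=> //.
  apply/E => i; move/forallP/(_ i): H.
  by rewrite !height_vertex take0 take_size rise_nil.
apply/forallP=> i; rewrite !height_vertex take0 take_size rise_nil.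
by move/E: H; apply.
Qed.

Lemma bridgeP w :
  reflect (self_avoiding w /\
           forall u v, w = u ++ v -> v <> [::] -> 0 <= rise u < rise w)
          (bridge w).
Proof.
apply: (iffP andP) => -[SA H]; split=> //.
  move=> u v Ew v0; have lti : (size u < (size w).+1)%N by rewrite Ew size_cat; lia.
  move/forallP/(_ (Ordinal lti)): H; rewrite !height_vertex /= take0 take_size.
  rewrite rise_nil !disp_vertex take_size.
  have -> : take (size u) w = u by rewrite Ew take_size_cat.
  move/implyP; apply; apply/eqP; rewrite Ew disp_cat => /eqP.
  rewrite -subr_eq0 opprD addNKr oppr_eq0 => /eqP.
  by apply: (self_avoidingP _ SA u v [::]) => //; rewrite cats0.
apply/forallP=> i; apply/implyP; rewrite !height_vertex take0 take_size rise_nil => nE.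
apply: (H _ (drop i w)); first by rewrite cat_take_drop.
move=> d0; have Ew := cat_take_drop i w; rewrite d0 cats0 in Ew.
by move: nE; rewrite !disp_vertex take_size Ew eqxx.
Qed.

Lemma self_avoiding_factor u s v : self_avoiding (u ++ s ++ v) -> self_avoiding s.
Proof.
move=> /self_avoidingP SA; apply/self_avoidingP => a b c E.
by apply: (SA (u ++ a) b (c ++ v)); rewrite E -!catA.
Qed.

Lemma self_avoiding_catl u v : self_avoiding (u ++ v) -> self_avoiding u.
Proof. exact: (@self_avoiding_factor [::]). Qed.

Lemma self_avoiding_catr u v : self_avoiding (u ++ v) -> self_avoiding v.
Proof. by rewrite -{1}(cats0 v) => /self_avoiding_factor. Qed.

Lemma bridge_nil : bridge [::].
Proof. by apply/bridgeP; split=> // -[|? ?] [|? ?]. Qed.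

Lemma weakly_directed_nil : weakly_directed [::].
Proof. by apply/weakly_directedP; split=> // -[|? ?] [|? ?] // _ _; exists North. Qed.

(** The portion between two vertices of a concatenation of bridges gains height
    as soon as it starts strictly before the junction and reaches it. *)
Lemma rise_across_junction b1 b2 u s1 s2 v : bridge b1 -> bridge b2 ->
  b1 = u ++ s1 -> s1 <> [::] -> b2 = s2 ++ v -> 0 < rise (s1 ++ s2).
Proof.
move=> /bridgeP[_ B1] /bridgeP[_ B2] E1 s1_neq0 E2.
have := B1 _ _ E1 s1_neq0; rewrite E1 !riseE.
case: v E2 => [|x v] E2; last by have := B2 _ _ E2 (@cons_neq_nil _ _ _); lia.
case: (eqVneq b2 [::]) => [b20|/eqP b2_neq0].
  by move: E2; rewrite b20; case: s2 => // _; rewrite rise_nil; lia.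
by have := B2 [::] b2 erefl b2_neq0; rewrite E2 cats0 rise_nil; lia.
Qed.

Lemma bridge_rise_ge0 w : bridge w -> 0 <= rise w.
Proof.
case: (eqVneq w [::]) => [-> _|/eqP w0 /bridgeP[_ H]]; first by rewrite rise_nil.
by have := H [::] w erefl w0; rewrite rise_nil; lia.
Qed.

Lemma bridge_cat u v : bridge u -> bridge v -> bridge (u ++ v).
Proof.
move=> Bu Bv; apply/bridgeP; split.
  apply/self_avoidingP => a s c E s0.
  case: (bridgeP _ Bu) (bridgeP _ Bv) => SAu _ [SAv _].
  case: (cat_eq_cat E) => -[e [E1 E2]]; last first.
    by apply: (self_avoidingP _ SAv e s c).
  case: (cat_eq_cat E2) => -[f [E3 E4]]; last first.
    by apply: (self_avoidingP _ SAu a s f); rewrite ?E1 ?E3.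
  case: (eqVneq e [::]) => [e0|/eqP e0].
    move: E3; rewrite e0 /= => E3; rewrite -E3 in E4.
    by apply: (self_avoidingP _ SAv [::] s c).
  have := rise_across_junction Bu Bv E1 e0 E4; rewrite -E3 /rise => + d0.
  by rewrite d0.
move=> a c E c0; rewrite rise_cat.
case: (cat_eq_cat E) => -[e [E1 E2]].
  case: (eqVneq e [::]) => [e0|/eqP e0].
    rewrite e0 cats0 /= in E1 E2; rewrite -E1.
    case/bridgeP: Bv => _ /(_ [::] c (esym E2) c0).
    by move: (bridge_rise_ge0 Bu); rewrite rise_nil; lia.
  case/bridgeP: (Bu) => _ /(_ _ _ E1 e0).
  by move: (bridge_rise_ge0 Bv); lia.
case/bridgeP: (Bv) => _ /(_ _ _ E2 c0); rewrite E1 rise_cat.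
by move: (bridge_rise_ge0 Bu); lia.
Qed.

(** Vertices on either side of the junction of two bridges lie at different
    heights, so weak directedness is a condition on each bridge separately. *)
Lemma weakly_directed_cat u v : bridge u -> bridge v ->
  weakly_directed (u ++ v) = weakly_directed u && weakly_directed v.
Proof.
move=> Bu Bv; apply/idP/andP => [/weakly_directedP[SA WD]|].
  split; apply/weakly_directedP; split.
  - exact: self_avoiding_catl SA.
  - by move=> a s c E; apply: (WD a s (c ++ v)); rewrite E -!catA.
  - exact: self_avoiding_catr SA.
  - by move=> a s c E; apply: (WD (u ++ a) s c); rewrite E -!catA.
case=> /weakly_directedP[SAu WDu] /weakly_directedP[SAv WDv].
apply/weakly_directedP; split; first by case/bridgeP: (bridge_cat Bu Bv).
move=> a s c E r0.
case: (cat_eq_cat E) => -[e [E1 E2]]; last exact: (WDv e s c).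
case: (cat_eq_cat E2) => -[f [E3 E4]]; last first.
  by apply: (WDu a s f); rewrite ?E1 ?E3.
case: (eqVneq e [::]) => [e0|/eqP e0].
  move: E3; rewrite e0 /= => E3; rewrite -E3 in E4.
  exact: (WDv [::] s c).
by have := rise_across_junction Bu Bv E1 e0 E4; rewrite -E3 r0.
Qed.

Lemma swalk_cat A u v : bridge u -> bridge v ->
  swalk A (u ++ v) = swalk A u && swalk A v.
Proof.
move=> Bu Bv; case/bridgeP: (bridge_cat Bu Bv) => SA _.
case/bridgeP: Bu => SAu _; case/bridgeP: Bv => SAv _.
by rewrite /swalk SA SAu SAv all_cat.
Qed.

(** * Irreducible bridges *)

(** A nonempty bridge that is not the concatenation of two nonempty bridges. *)
Definition irreducible (w : seq step) : bool :=
  [&& bridge w, w != [::] &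
      ~~ [exists i : 'I_(size w).+1,
           [&& (0 < i < size w)%N, bridge (take i w) & bridge (drop i w)]]].

Lemma irreducibleP w :
  reflect [/\ bridge w, w <> [::] &
           forall u v, w = u ++ v -> bridge u -> bridge v -> u = [::] \/ v = [::]]
          (irreducible w).
Proof.
apply: (iffP and3P) => -[Bw w0 H]; split=> //; try exact/eqP.
  move=> u v E Bu Bv; case: (eqVneq u [::]) => [|u0]; first by left.
  case: (eqVneq v [::]) => [|v0]; first by right.
  case/negP: H; apply/existsP.
  have lti : (size u < (size w).+1)%N by rewrite E size_cat; lia.
  exists (Ordinal lti); rewrite /= E take_size_cat // drop_size_cat // Bu Bv.
  by move: u0 v0; rewrite !andbT size_cat; case: (u) (v) => [|? ?] [|? ?] //= _ _; lia.
apply/negP => /existsP[i /and3P[Hi B1 B2]].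
case: (H _ _ (esym (cat_take_drop i w)) B1 B2) => /(congr1 size).
  by rewrite size_takel /=; lia.
by rewrite size_drop /=; lia.
Qed.

Lemma bridge_first_factor w : bridge w -> w <> [::] ->
  exists u v, [/\ w = u ++ v, irreducible u & bridge v].
Proof.
elim: {w}(size w).+1 {-2}w (ltnSn (size w)) => // n IHn w le_wn Bw w0.
case: (boolP [exists i : 'I_(size w).+1,
    [&& (0 < i < size w)%N, bridge (take i w) & bridge (drop i w)]]) => [|nex].
  case/existsP => i /and3P[Hi B1 B2].
  have st : size (take i w) = i by rewrite size_takel; lia.
  have [||u [v [E Iu Bv]]] := IHn (take i w) _ B1.
  - by rewrite st; lia.
  - by move/(congr1 size); rewrite st /=; lia.
  exists u, (v ++ drop i w); split=> //; last exact: bridge_cat.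
  by rewrite catA -E cat_take_drop.
exists w, [::]; split; rewrite ?cats0 // ?bridge_nil //.
by rewrite /irreducible Bw nex andbT; apply/eqP.
Qed.

(** If one of two irreducible prefixes with bridges as complements were longer,
    the difference would be a bridge, being a prefix of one bridge and a suffix
    of the other. *)
Lemma irreducible_factor_size u v u' v' :
  irreducible u -> bridge v -> irreducible u' -> bridge v' ->
  u ++ v = u' ++ v' -> size u = size u'.
Proof.
suff H a b c d : irreducible a -> bridge b -> irreducible (a ++ c) ->
    b = c ++ d -> c = [::].
  move=> Iu Bv Iu' Bv' /cat_eq_cat[] [e [E1 E2]]; rewrite E1 ?cats0.
    by rewrite E1 in Iu; rewrite (H _ _ _ _ Iu' Bv' Iu E2) cats0.
  by rewrite E1 in Iu'; rewrite (H _ _ _ _ Iu Bv Iu' E2) cats0.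
move=> /irreducibleP[Ba a0 _] Bb /irreducibleP[Bac _ H] Eb.
suff Bc : bridge c by case: (H _ _ erefl Ba Bc).
apply/bridgeP; split; first by case/bridgeP: Bac => /self_avoiding_catr.
move=> x y Ec y0.
case/bridgeP: Bb => _ /(_ x (y ++ d)); rewrite Eb Ec -catA => /(_ erefl).
case/bridgeP: Bac => _ /(_ (a ++ x) y); rewrite Ec -catA => /(_ erefl y0).
rewrite !riseE => H1; case: (y) y0 H1 => // z y1 _ H1 /(_ (@cons_neq_nil _ _ _)); lia.
Qed.

(** * Weakly directed irreducible bridges *)

(** A self-avoiding word in two opposite steps never turns back. *)
Lemma self_avoiding_line a b w : dir a + dir b = 0 -> self_avoiding w ->
  all (pred2 a b) w -> exists m, w = nseq m a \/ w = nseq m b.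
Proof.
move=> ab; elim: w => [|x w IHw] SA /=; first by exists 0%N; left.
case/andP => xab /(IHw (@self_avoiding_catr [:: x] w SA)) [m Em].
case: m Em => [|m] Em.
  by exists 1%N; case: Em xab => -> /orP[]/eqP-> ; [left | right | left | right].
have back y w' : w = y :: w' -> dir x + dir y <> 0.
  move=> E; move/self_avoidingP: SA => /(_ [::] [:: x; y] w'); rewrite E.
  by rewrite !disp_cons disp_nil addr0; apply.
exists m.+2; case: Em => Ew; case/orP: xab => /eqP xE; rewrite xE Ew /=; auto.
  by case: (back _ _ Ew); rewrite xE addrC.
by case: (back _ _ Ew); rewrite xE.
Qed.

Lemma rise_horizontal w : North \notin w \/ South \notin w -> rise w = 0 ->
  all (pred2 East West) w.
Proof.
case=> Nw r0.
- have H : rise w <= 0 /\ (rise w = 0 -> all (pred2 East West) w).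
    elim: w Nw {r0} => [|x w IHw]; rewrite ?rise_nil // in_cons negb_or.
    case/andP=> + /IHw[le0 H]; rewrite rise_cons.
    case: x; rewrite ?eqxx //= => _; (split=> [|E]; first lia);
      by rewrite ?eqxx ?orbT /=; (exfalso; lia) || (apply: H; lia).
  by case: H => _; apply.
- have H : 0 <= rise w /\ (rise w = 0 -> all (pred2 East West) w).
    elim: w Nw {r0} => [|x w IHw]; rewrite ?rise_nil // in_cons negb_or.
    case/andP=> + /IHw[le0 H]; rewrite rise_cons.
    case: x; rewrite ?eqxx //= => _; (split=> [|E]; first lia);
      by rewrite ?eqxx ?orbT /=; (exfalso; lia) || (apply: H; lia).
  by case: H => _; apply.
Qed.

(** A portion between vertices of equal height, with both horizontal
    directions, would have to avoid North or South, hence be horizontal, and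
    would turn back. *)
Lemma weakly_directed_one_sided w u s v : weakly_directed w -> w = u ++ s ++ v ->
  rise s = 0 -> East \in s -> West \in s -> False.
Proof.
move=> /weakly_directedP[SA WD] E r0 Es Ws.
have [x xs] := WD _ _ _ E r0.
have hor : all (pred2 East West) s.
  by apply: rise_horizontal r0; case: x xs => xs; rewrite ?Es ?Ws // in xs *; auto.
rewrite E in SA; have SAs := self_avoiding_factor SA.
have [|m [] Em] := self_avoiding_line _ SAs hor; first by [].
  by move: Ws; rewrite Em mem_nseq => /andP[_ /eqP].
by move: Es; rewrite Em mem_nseq => /andP[_ /eqP].
Qed.

(** Two horizontal steps of opposite directions that are consecutive among
    the horizontal steps. *)
Lemma turn_factor w : East \in w -> West \in w ->
  exists u x s y v, [/\ w = u ++ x :: s ++ y :: v,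
    (x, y) \in [:: (East, West); (West, East)] & all (pred2 North South) s].
Proof.
have first_occ (y : step) l : y \in l ->
    exists s v, l = s ++ y :: v /\ y \notin s.
  elim: l => // z l IHl; rewrite in_cons; case: (eqVneq y z) => [-> _|nyz /=].
    by exists [::], l.
  move=> /IHl[s [v [-> ys]]]; exists (z :: s), v.
  by rewrite in_cons negb_or nyz.
have vertical s : East \notin s -> West \notin s -> all (pred2 North South) s.
  move=> Es Ws; apply/allP => -[] H; rewrite /= ?eqxx ?orbT //.
      by rewrite H in Es.
    by rewrite H in Ws.
elim: w => // a w IHw; rewrite !in_cons.
case: (boolP ((East \in w) && (West \in w))) => [/andP[Ew Ww] _ _|].
  have [u [x [s [y [v [-> ? ?]]]]]] := IHw Ew Ww.
  by exists (a :: u), x, s, y, v.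
move=> nEW; case: a.
- by move=> /orP[/eqP//|Ew] /orP[/eqP//|Ww]; rewrite Ew Ww in nEW.
- move=> _ /orP[/eqP//|Ww]; rewrite Ww andbT in nEW.
  have [s [v [E Ws]]] := first_occ _ _ Ww.
  exists [::], East, s, West, v; split; rewrite ?E ?inE ?eqxx //.
  by apply: vertical => //; apply: contraNN nEW; rewrite E mem_cat => ->.
- by move=> /orP[/eqP//|Ew] /orP[/eqP//|Ww]; rewrite Ew Ww in nEW.
- move=> /orP[/eqP//|Ew] _; rewrite Ew /= in nEW.
  have [s [v [E Es]]] := first_occ _ _ Ew.
  exists [::], West, s, East, v; split; rewrite ?E ?inE ?eqxx ?orbT //.
  by apply: vertical => //; apply: contraNN nEW; rewrite E mem_cat => ->.
Qed.

(** A discrete intermediate value theorem: steps change the height by at most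
    one. *)
Lemma rise_ivt (w : seq step) (k : int) : 0 <= k <= rise w ->
  exists u v, w = u ++ v /\ rise u = k.
Proof.
elim/last_ind: w => [|w x IHw] Hk.
  by exists [::], [::]; rewrite rise_nil in Hk *; split=> //; lia.
case: (boolP (k <= rise w)) => [le_k|nle_k].
  have [|u [v [-> <-]]] := IHw; first by lia.
  by exists u, (rcons v x); rewrite rcons_cat.
exists (rcons w x), [::]; rewrite cats0; split=> //.
move: Hk nle_k; rewrite -cats1 !riseE; case: x => /=; lia.
Qed.

Lemma rise_max (w : seq step) : exists u v, w = u ++ v /\
  forall u' v', w = u' ++ v' -> rise u' <= rise u.
Proof.
elim: w => [|x w [u [v [E H]]]].
  by exists [::], [::]; split=> // -[|? ?] [].
case: (boolP (0 <= (dir x).2 + rise u)) => Hx.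
  exists (x :: u), v; split; first by rewrite E.
  by move=> [|y u'] v' /=; rewrite ?riseE // => -[<- /H]; lia.
exists [::], (x :: w); split=> //.
by move=> [|y u'] v' /=; rewrite ?riseE // => -[<- /H]; lia.
Qed.

(** A weakly directed bridge with both horizontal directions can be cut on the
    vertical run between two opposite horizontal steps. *)
Lemma weakly_directed_irreducible w : weakly_directed w -> irreducible w ->
  (East \notin w) || (West \notin w).
Proof.
move=> WD /irreducibleP[Bw _ Irr]; rewrite -negb_and; apply/negP => /andP[Ew Ww].
have [u [x [s [y [v [E xy vs]]]]]] := turn_factor Ew Ww.
case/bridgeP: (Bw) => SA Hw.
have [x2 y2] : (dir x).2 = 0 /\ (dir y).2 = 0.
  by move: xy; rewrite !inE => /orP[]/eqP[-> ->].
(* No height is attained both before x and after y. *)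
have disjoint u1 u2 v1 v2 : u = u1 ++ u2 -> v = v1 ++ v2 ->
    rise u1 <> rise (u ++ x :: s ++ y :: v1).
  move=> Eu Ev Er; apply: (@weakly_directed_one_sided w u1
    (u2 ++ x :: s ++ y :: v1) v2 WD).
  - by rewrite E Eu Ev -!(catA, cat_cons).
  - by move: Er; rewrite Eu !riseE; lia.
  - move: xy; rewrite !inE => /orP[]/eqP[-> ->];
    by rewrite !(mem_cat, in_cons) eqxx !orbT.
  - move: xy; rewrite !inE => /orP[]/eqP[-> ->];
    by rewrite !(mem_cat, in_cons) eqxx !orbT.
(* So all heights before x are smaller than all heights after y. *)
have below u1 u2 v1 v2 : u = u1 ++ u2 -> v = v1 ++ v2 ->
    rise u1 < rise (u ++ x :: s ++ y :: v1).
  move=> Eu Ev; rewrite ltNge; apply/negP => le.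
  have ge0 : 0 <= rise (u ++ x :: s ++ y :: v1).
    case: v2 Ev => [|z v2] Ev.
      by rewrite cats0 in Ev; rewrite -Ev -E; exact: bridge_rise_ge0.
    have /Hw : w = (u ++ x :: s ++ y :: v1) ++ z :: v2.
      by rewrite E Ev -!(catA, cat_cons).
    by case/(_ (@cons_neq_nil _ _ _))/andP.
  have [|u0 [u3 [Eu1 Er]]] := @rise_ivt u1 (rise (u ++ x :: s ++ y :: v1)).
    by rewrite ge0.
  by apply: (disjoint u0 (u3 ++ u2) v1 v2) => //; rewrite Eu Eu1 catA.
have SAs : self_avoiding s.
  move: SA; rewrite E => /self_avoiding_catr.
  by move=> /(@self_avoiding_catr [:: x]) /self_avoiding_catl.
have [m Em] : exists m, s = nseq m North.
  have [|m [] Em] := @self_avoiding_line North South s _ SAs vs; first by [].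
    by exists m.
  have := below u [::] [::] v (esym (cats0 u)) erefl.
  by rewrite Em !riseE rise_nseqS; lia.
have [u1 [u2 [Eu max]]] := rise_max u.
(* The cut is made where the vertical run first exceeds the heights before x. *)
pose r := absz (rise u1 - rise u + 1).
have le_u := max u [::] (esym (cats0 u)).
have r_gt0 : (0 < r)%N by rewrite /r; lia.
have r_le : (r <= m)%N.
  have := below u1 u2 [::] v Eu erefl.
  by rewrite Em !riseE rise_nseqN /r; lia.
have rE : r%:Z = rise u1 - rise u + 1 by rewrite /r; lia.
set w1 := u ++ x :: nseq r North; set w2 := nseq (m - r) North ++ y :: v.
have Ew12 : w = w1 ++ w2.
  by rewrite E /w1 /w2 Em -{1}(subnKC r_le) nseqD -!(catA, cat_cons).
have rise1 : rise w1 = rise u1 + 1 by rewrite /w1 !riseE rise_nseqN; lia.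
have B1 : bridge w1.
  apply/bridgeP; split; first by rewrite Ew12 in SA; exact: self_avoiding_catl SA.
  move=> a b Eab b0.
  have -> /= : 0 <= rise a.
    have /Hw : w = a ++ (b ++ w2) by rewrite Ew12 Eab catA.
    by case/(_ _)/andP => //; case: (b) b0.
  rewrite rise1; case: (cat_eq_cat Eab) => -[e [E1 E2]].
    by have := max _ _ E1; lia.
  case: e E1 E2 => [|z e] E1; first by have := max u [::]; rewrite E1 !cats0; lia.
  case=> Ez E2; rewrite E1 -Ez !riseE x2.
  have Ne : e = nseq (size e) North.
    have := congr1 (take (size e)) E2; rewrite take_size_cat // take_nseq //.
    by have := congr1 size E2; rewrite size_nseq size_cat; lia.
  have := congr1 size E2; rewrite Ne rise_nseqN size_nseq size_cat size_nseq.
  by case: (b) b0 => // ? ? _ /=; lia.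
have B2 : bridge w2.
  apply/bridgeP; split; first by rewrite Ew12 in SA; exact: self_avoiding_catr SA.
  move=> a b Eab b0.
  have lt : rise a < rise w2.
    have /Hw : w = (w1 ++ a) ++ b by rewrite Ew12 Eab catA.
    by move=> /(_ b0); rewrite Ew12 !rise_cat; lia.
  rewrite lt andbT; case: (cat_eq_cat Eab) => -[e [E1 E2]].
    suff -> : a = nseq (size a) North by rewrite rise_nseqN.
    have := congr1 (take (size a)) E1; rewrite take_size_cat // take_nseq //.
    by have := congr1 size E1; rewrite size_nseq size_cat; lia.
  case: e E1 E2 => [|z e] E1; first by rewrite E1 cats0 rise_nseqN.
  case=> Ez E2; rewrite E1 -Ez.
  have := below u1 u2 e b Eu E2; rewrite Em !riseE !rise_nseqN y2 x2.
  by rewrite -subzn //; lia.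
by case: (Irr _ _ Ew12 B1 B2) => /(congr1 size); rewrite size_cat /=; lia.
Qed.

Lemma weakly_directed_avoid x w : self_avoiding w -> x \notin w -> weakly_directed w.
Proof.
move=> SA xw; apply/weakly_directedP; split=> // u s v E _; exists x.
by apply: contraNN xw => xs; rewrite E !mem_cat xs orbT.
Qed.

(** The mirror image of [NES] in a vertical line. *)
Definition NWS : {set step} := [set North; West; South].

Lemma swalk_NES w : swalk NES w = self_avoiding w && (West \notin w).
Proof.
rewrite /swalk; congr (_ && _); rewrite -has_pred1 -all_predC; apply: eq_all.
by case; rewrite /= !inE; do ![case: eqP => // _].
Qed.

Lemma swalk_NWS w : swalk NWS w = self_avoiding w && (East \notin w).
Proof.
rewrite /swalk; congr (_ && _); rewrite -has_pred1 -all_predC; apply: eq_all.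
by case; rewrite /= !inE; do ![case: eqP => // _].
Qed.

Lemma irreducible_weakly_directed w : irreducible w ->
  weakly_directed w = swalk NES w || swalk NWS w.
Proof.
move=> Iw; have SA : self_avoiding w by case/irreducibleP: Iw => /bridgeP[].
rewrite swalk_NES swalk_NWS SA /=; apply/idP/orP => [WD|[]].
- by case/orP: (weakly_directed_irreducible WD Iw); [right | left].
- exact: weakly_directed_avoid.
- exact: weakly_directed_avoid.
Qed.

(** The last step of a bridge is North; before it, the walk stays between its
    first and last heights. *)
Lemma bridge_rcons w x : bridge (rcons w x) = (x == North) && pseudo_bridge w.
Proof.
apply/bridgeP/andP => [[SA H]|[/eqP-> /pseudo_bridgeP[SA H]]].
  have := H w [:: x] (esym (cats1 w x)) (@cons_neq_nil _ _ _).
  rewrite -cats1 !riseE => Hx.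
  have xN : x = North by case: (x) Hx => //=; lia.
  rewrite xN eqxx; split=> //; apply/pseudo_bridgeP; split.
    by move: SA; rewrite -cats1; exact: self_avoiding_catl.
  move=> u v E; have Ex : rcons w x = u ++ rcons v x by rewrite E rcons_cat.
  have v0 : rcons v x <> [::] by case: (v).
  by have := H _ _ Ex v0; rewrite -[rcons w x]cats1 !riseE xN /=; lia.
split.
  apply/self_avoidingP => u s v; case/lastP: v => [|v y].
    case/lastP: s => // s y; rewrite cats0 -rcons_cat => /rcons_inj[E <-] _.
    have := H _ _ E; have := H _ _ (esym (cats0 w)); rewrite E rise_cat.
    move=> H1 H2 d0; have : rise (rcons s North) = 0 by rewrite /rise d0.
    by rewrite -cats1 !riseE /=; lia.
  by rewrite -!rcons_cat => /rcons_inj[E _]; exact: (self_avoidingP _ SA _ _ _ E).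
move=> u v; case/lastP: v => // v y; rewrite -rcons_cat => /rcons_inj[E _] _.
by have := H _ _ E; rewrite -cats1 !riseE /=; lia.
Qed.

(** * Reflection in a vertical line *)

(** The reflection in a vertical line, on steps and then on words. *)
Definition reflect_step (s : step) : step :=
  match s with East => West | West => East | _ => s end.

Notation mirror := (map reflect_step).

Lemma reflect_stepK : involutive reflect_step. Proof. by case. Qed.

Lemma mirrorK : involutive mirror.
Proof. exact: mapK reflect_stepK. Qed.

Lemma disp_mirror w : disp (mirror w) = (- (disp w).1, (disp w).2).
Proof.
elim: w => [|x w IHw] /=; first by rewrite disp_nil.
by rewrite !disp_cons IHw; case: x => /=; congr pair => /=; lia.
Qed.

Lemma rise_mirror w : rise (mirror w) = rise w.
Proof. by rewrite /rise disp_mirror. Qed.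

Lemma mirror_cat_inv w u v : mirror w = u ++ v -> w = mirror u ++ mirror v.
Proof. by move/(congr1 mirror); rewrite mirrorK map_cat. Qed.

Lemma mirror_neq_nil w : w <> [::] -> mirror w <> [::].
Proof. by case: w. Qed.

Lemma self_avoiding_mirror w : self_avoiding (mirror w) = self_avoiding w.
Proof.
suff H v : self_avoiding v -> self_avoiding (mirror v).
  by apply/idP/idP => [/H|/H //]; rewrite mirrorK.
move=> /self_avoidingP SA; apply/self_avoidingP => a s b.
move=> /mirror_cat_inv; rewrite map_cat => E /mirror_neq_nil s0 d0.
apply: (SA _ _ _ E s0); rewrite disp_mirror d0 /=.
by congr pair; lia.
Qed.

Lemma bridge_mirror w : bridge (mirror w) = bridge w.
Proof.
suff H v : bridge v -> bridge (mirror v).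
  by apply/idP/idP => [/H|/H //]; rewrite mirrorK.
move=> /bridgeP[SA H]; apply/bridgeP; rewrite self_avoiding_mirror; split=> //.
move=> a b /mirror_cat_inv E /mirror_neq_nil b0.
by have := H _ _ E b0; rewrite !rise_mirror.
Qed.

Lemma irreducible_mirror w : irreducible (mirror w) = irreducible w.
Proof.
suff H v : irreducible v -> irreducible (mirror v).
  by apply/idP/idP => [/H|/H //]; rewrite mirrorK.
move=> /irreducibleP[Bv v0 H]; apply/irreducibleP; split.
- by rewrite bridge_mirror.
- exact: mirror_neq_nil.
move=> a b /mirror_cat_inv E Ba Bb.
have := H _ _ E; rewrite !bridge_mirror => /(_ Ba Bb).
by case=> /(congr1 size); rewrite size_map /= => /size0nil; [left | right].
Qed.

Lemma swalk_mirror w : swalk NWS (mirror w) = swalk NES w.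
Proof.
rewrite swalk_NES swalk_NWS self_avoiding_mirror; congr (_ && ~~ _).
by rewrite -[East]/(reflect_step West) mem_map //; exact: inv_inj reflect_stepK.
Qed.

(** * Length generating functions *)

Lemma eq_length_gf C D : C =1 D -> length_gf C = length_gf D.
Proof.
by move=> CD; apply/fpsP => n /=; congr Posz; apply: eq_card => w; rewrite !inE CD.
Qed.

Lemma length_gf_or C D :
  length_gf (fun w => C w || D w) =
  length_gf C + length_gf D - length_gf (fun w => C w && D w).
Proof.
apply/fpsP => n; rewrite !(fcoefD, fcoefN) /=.
have := cardsUI [set w : n.-tuple step | C w] [set w : n.-tuple step | D w].
have -> : [set w : n.-tuple step | C w] :|: [set w : n.-tuple step | D w] =
  [set w : n.-tuple step | C w || D w] by apply/setP => w; rewrite !inE.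
have -> : [set w : n.-tuple step | C w] :&: [set w : n.-tuple step | D w] =
  [set w : n.-tuple step | C w && D w] by apply/setP => w; rewrite !inE.
by move=> E; rewrite -PoszD -E PoszD addrK.
Qed.

Lemma length_gf_map (f : step -> step) C : involutive f ->
  length_gf (fun w => C (map f w)) = length_gf C.
Proof.
move=> fK; apply/fpsP => n /=; congr Posz.
have inj : injective (map_tuple f : n.-tuple step -> n.-tuple step).
  by move=> u v /(congr1 val) /(inj_map (inv_inj fK)) /val_inj.
rewrite -[RHS](card_preimset _ inj).
by apply: eq_card => w; rewrite !inE.
Qed.

Lemma length_gf_pred1 (w : seq step) n :
  fcoef (length_gf (pred1 w)) n = (n == size w)%:R.
Proof.
rewrite /=; case: eqP => [->|nE].
  rewrite (_ : [set _ | _] = [set in_tuple w]) ?cards1 //.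
  by apply/setP => v; rewrite !inE -val_eqE.
rewrite (_ : [set _ | _] = set0) ?cards0 //.
apply/setP => v; rewrite !inE; apply/negP => /eqP E.
by apply: nE; rewrite -E size_tuple.
Qed.

Lemma length_gf_nil : length_gf (pred1 [::]) = 1.
Proof. by apply/fpsP => n; rewrite length_gf_pred1. Qed.

Lemma length_gf_step x : length_gf (pred1 [:: x]) = fpsX int.
Proof. by apply/fpsP => n; rewrite length_gf_pred1. Qed.

Lemma card_disjoint_cases (T : finType) m (C : pred T) (D : nat -> pred T) :
  (forall w, C w -> exists2 k, (k < m)%N & D k w) ->
  (forall w k, D k w -> C w) ->
  (forall w k l, D k w -> D l w -> k = l) ->
  #|[set w | C w]| = (\sum_(k < m) #|[set w | D k w]|)%N.
Proof.
move=> ex sub uniqD.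
have -> : (\sum_(k < m) #|[set w | D k w]| =
    \sum_(k < m) \sum_(w in T) D k w)%N.
  apply: eq_bigr => k _; rewrite -sum1_card big_mkcond /=.
  by apply: eq_bigr => w _; rewrite inE; case: (D k w).
rewrite exchange_big -sum1_card big_mkcond; apply: eq_bigr => w _ /=.
rewrite inE; case: (boolP (C w)) => [Cw|nCw]; last first.
  by rewrite big1 // => k _; case: (boolP (D k w)) => // /sub; rewrite (negbTE nCw).
have [k lt_km Dk] := ex _ Cw.
rewrite (bigD1 (Ordinal lt_km)) //= Dk big1 // => l nl.
case: (boolP (D l w)) => // Dl; case/eqP: nl; apply: val_inj; exact: uniqD Dl Dk.
Qed.

Lemma card_cat_words (A B : pred (seq step)) n i : (i <= n)%N ->
  #|[set w : n.-tuple step | A (take i w) && B (drop i w)]| =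
  (#|[set u : i.-tuple step | A u]| * #|[set v : (n - i).-tuple step | B v]|)%N.
Proof.
move=> le_in; rewrite -cardsX.
pose f (p : i.-tuple step * (n - i).-tuple step) : n.-tuple step :=
  tcast (subnKC le_in) (cat_tuple p.1 p.2).
have fE p : f p = p.1 ++ p.2 :> seq step by rewrite val_tcast.
have inj : injective f.
  move=> [u v] [u' v'] /(congr1 val) /=; rewrite !fE /= => /eqP.
  by rewrite eqseq_cat ?size_tuple // => /andP[/eqP/val_inj-> /eqP/val_inj->].
rewrite -(card_imset _ inj); apply: eq_card => w; rewrite !inE.
apply/idP/imsetP => [/andP[Aw Bw]|[[u v]]]; last first.
  rewrite !inE => Auv ->; rewrite fE /= take_size_cat ?size_tuple //.
  by rewrite drop_size_cat ?size_tuple.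
have s1 : size (take i w) == i by rewrite size_takel ?size_tuple.
have s2 : size (drop i w) == (n - i)%N by rewrite size_drop size_tuple.
exists (Tuple s1, Tuple s2); first by rewrite !inE Aw.
by apply: val_inj; rewrite /= fE /= cat_take_drop.
Qed.

(** The product rule for a class of words with unique factorizations. *)
Lemma length_gf_cat (A B C : pred (seq step)) :
  (forall u v, A u -> B v -> C (u ++ v)) ->
  (forall w, C w -> exists u v, [/\ w = u ++ v, A u & B v]) ->
  (forall u v u' v', A u -> B v -> A u' -> B v' -> u ++ v = u' ++ v' ->
     size u = size u') ->
  length_gf C = length_gf A * length_gf B.
Proof.
move=> CAB exAB uniqAB; apply/fpsP => n; rewrite fcoefM /=.
pose D k (w : n.-tuple step) := [&& (k <= n)%N, A (take k w) & B (drop k w)].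
rewrite (@card_disjoint_cases _ n.+1 _ D).
- rewrite (big_morph Posz PoszD (erefl 0%:Z)); apply: eq_bigr => i _.
  rewrite -PoszM -card_cat_words; last by rewrite -ltnS.
  by congr Posz; apply: eq_card => w; rewrite !inE /D -ltnS ltn_ord.
- move=> w /exAB[u [v [E Au Bv]]].
  have sn : (size u + size v = n)%N by rewrite -size_cat -E size_tuple.
  exists (size u); first by lia.
  by rewrite /D E take_size_cat // drop_size_cat // Au Bv andbT; lia.
- by move=> w k /and3P[_ Aw Bw]; rewrite -(cat_take_drop k w); exact: CAB.
move=> w k l /and3P[le_k Ak Bk] /and3P[le_l Al Bl].
have := uniqAB _ _ _ _ Ak Bk Al Bl; rewrite !cat_take_drop => /(_ erefl).
by rewrite !size_takel ?size_tuple.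
Qed.

Lemma length_gf_nonempty (C : pred (seq step)) : C [::] ->
  length_gf C = 1 + length_gf (fun w => C w && (w != [::])).
Proof.
move=> C0; rewrite -length_gf_nil.
rewrite (@eq_length_gf C (fun w => pred1 [::] w || (C w && (w != [::])))).
  rewrite length_gf_or -[RHS]subr0; congr (_ - _); apply/fpsP => n /=.
  congr Posz; apply: eq_card0 => w; rewrite !inE /=.
  by case: eqP => //= _; rewrite andbF.
by move=> w /=; case: eqP => [->|_] //=; rewrite andbT.
Qed.

(** * Bridges as sequences of irreducible bridges *)

(** For a class [P] of bridges that is stable under concatenation and under
    taking factors, a nonempty bridge in [P] is uniquely an irreducible bridge
    in [P] followed by a bridge in [P]. *)
Lemma bridge_gf_irreducible (P : pred (seq step)) : P [::] ->
  (forall u v, bridge u -> bridge v -> P (u ++ v) = P u && P v) ->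
  length_gf (fun w => P w && bridge w) =
  1 + length_gf (fun w => P w && irreducible w) *
      length_gf (fun w => P w && bridge w).
Proof.
move=> P0 Pcat; rewrite {1}length_gf_nonempty ?P0 ?bridge_nil //; congr (1 + _).
apply: length_gf_cat.
- move=> u v /andP[Pu /irreducibleP[Bu u0 _]] /andP[Pv Bv].
  by rewrite Pcat // Pu Pv bridge_cat //=; case: (u) u0.
- move=> w /andP[/andP[Pw Bw] /eqP w0].
  have [u [v [E Iu Bv]]] := bridge_first_factor Bw w0.
  have Bu : bridge u by case/irreducibleP: Iu.
  by move: Pw; rewrite E Pcat // => /andP[Pu Pv]; exists u, v; rewrite Pu Iu Pv.
- move=> u v u' v' /andP[_ Iu] /andP[_ Bv] /andP[_ Iu'] /andP[_ Bv'].
  exact: irreducible_factor_size.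
Qed.

(** A nonempty NES-bridge is an NES-pseudo-bridge followed by a North step. *)
Lemma NES_bridge_gf :
  length_gf (fun w => swalk NES w && bridge w) = 1 + fpsX int * NES_pb_gf.
Proof.
rewrite length_gf_nonempty ?bridge_nil //; congr (1 + _).
rewrite mulrC -(length_gf_step North); apply: length_gf_cat.
- move=> u v /andP[Su Bu] /eqP->; rewrite cats1 bridge_rcons eqxx Bu /=.
  have /bridgeP[SA _] : bridge (rcons u North) by rewrite bridge_rcons eqxx.
  rewrite andbT -size_eq0 size_rcons andbT swalk_NES SA mem_rcons inE negb_or.
  by move: Su; rewrite swalk_NES => /andP[_ ->]; rewrite andbT; apply/eqP.
- move=> w /andP[/andP[Sw Bw] w0]; case/lastP: w w0 Sw Bw => // u x _ Sw.
  rewrite bridge_rcons => /andP[/eqP xN Bu]; exists u, [:: North].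
  rewrite cats1 xN Bu andbT; split; rewrite /= ?eqxx //.
  move: Sw; rewrite !swalk_NES -cats1 mem_cat negb_or => /andP[SA /andP[-> _]].
  by rewrite (self_avoiding_catl SA).
- move=> u v u' v' _ /eqP-> _ /eqP-> /(congr1 size).
  by rewrite !size_cat => /addIn.
Qed.

Lemma bridge_nseqN k : bridge (nseq k North).
Proof.
apply/bridgeP; split.
  apply/self_avoidingP => u s v E s0 d0.
  have : rise s = 0 by rewrite /rise d0.
  suff -> : s = nseq (size s) North by rewrite rise_nseqN; case: (s) s0.
  apply/all_pred1P; have := all_pred1_nseq North k.
  by rewrite E !all_cat => /and3P[].
move=> u v E v0; have := all_pred1_nseq North k.
rewrite E all_cat => /andP[/all_pred1P-> /all_pred1P Ev].
by rewrite rise_cat Ev !rise_nseqN; case: (v) v0 => //= *; lia.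
Qed.

(** The only irreducible bridge with vertical steps alone is a single North
    step. *)
Lemma irreducible_NES_NWS w :
  (swalk NES w && irreducible w) && (swalk NWS w && irreducible w) =
  (w == [:: North]).
Proof.
rewrite swalk_NES swalk_NWS; apply/idP/eqP => [|->].
  case/andP=> /andP[/andP[SA Ww] Iw] /andP[/andP[_ Ew] _].
  case/irreducibleP: Iw => Bw w0 Irr.
  have vert : all (pred2 North South) w.
    apply/allP => -[] H; rewrite /= ?eqxx ?orbT //; first by rewrite H in Ew.
    by rewrite H in Ww.
  have [|m [] Em] := self_avoiding_line _ SA vert; first by [].
    case: m Em => [|[|m]] Em //.
    by case: (Irr [:: North] (nseq m.+1 North) Em (bridge_nseqN 1)
      (bridge_nseqN m.+1)).
  have := bridge_rise_ge0 Bw; rewrite Em rise_nseqS.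
  by case: m Em => [/w0|m _] //; lia.
have -> : irreducible [:: North].
  apply/irreducibleP; split=> //; first exact: (bridge_nseqN 1).
  by move=> [|x [|y u]] [|z v] //; auto.
have /bridgeP[/= -> _] := bridge_nseqN 1.
by rewrite !inE; do ![case: eqP => // _].
Qed.

(** A weakly directed irreducible bridge uses NES steps or NWS steps, and a
    single North step is of both kinds. *)
Lemma irreducible_wd_gf :
  length_gf (fun w => weakly_directed w && irreducible w) =
  2 * length_gf (fun w => swalk NES w && irreducible w) - fpsX int.
Proof.
rewrite (@eq_length_gf _ (fun w => (swalk NES w && irreducible w) ||
                                  (swalk NWS w && irreducible w))); last first.
  move=> w; rewrite -andb_orl.
  case: (boolP (irreducible w)) => [Iw|]; last by rewrite !andbF.
  by rewrite irreducible_weakly_directed.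
rewrite length_gf_or (eq_length_gf irreducible_NES_NWS) length_gf_step.
rewrite -[in X in _ + X - _](length_gf_map _ reflect_stepK).
rewrite (@eq_length_gf (fun w => swalk NWS (mirror w) && irreducible (mirror w))
                       (fun w => swalk NES w && irreducible w)).
  by rewrite mulr_natl mulr2n.
by move=> w; rewrite swalk_mirror irreducible_mirror.
Qed.

(** A walk of length n has height at most n, so the n-th coefficient is final
    after n + 1 terms. *)
Lemma NES_pb_gf_has_sum : fps_has_sum NES_pb_height_gf NES_pb_gf.
Proof.
move=> n; exists n.+1 => m le_nm; rewrite fcoef_sum /=.
pose D k (w : n.-tuple step) :=
  [&& swalk NES w, pseudo_bridge w & walk_height w == k%:Z].
rewrite -(big_morph Posz PoszD (erefl 0%:Z)); congr Posz; symmetry.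
apply: (@card_disjoint_cases _ m _ D).
- move=> w /andP[Sw Pw]; have hw : walk_height w = rise w.
    by rewrite /walk_height !height_vertex take_size take0 rise_nil subr0.
  have ge0 : 0 <= rise w.
    by case/pseudo_bridgeP: Pw => _ /(_ w [::] (esym (cats0 _)))/andP[].
  have le := rise_size w; rewrite size_tuple in le.
  case: (rise w) hw ge0 le => // k hw _ le; exists k; first by lia.
  by rewrite /D Sw Pw hw eqxx.
- by move=> w k /and3P[-> ->].
by move=> w k l /and3P[_ _ /eqP E] /and3P[_ _]; rewrite E => /eqP[].
Qed.

Theorem proposition13 :
  let t : fps int := fpsX int in
  let W : fps int := wd_bridge_gf in
  let B : fps int := NES_pb_gf in
  fps_has_sum NES_pb_height_gf B /\
  W = 1 / (1 + t - (2 * t * B) / (1 + t * B)).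
Proof.
move=> t W B; split; first exact: NES_pb_gf_has_sum.
pose I := length_gf (fun w => swalk NES w && irreducible w).
have eqF : 1 + t * B = 1 + I * (1 + t * B).
  rewrite -NES_bridge_gf; apply: bridge_gf_irreducible => // u v.
  exact: swalk_cat.
have eqW : W = 1 + (2 * I - t) * W.
  rewrite -irreducible_wd_gf; apply: bridge_gf_irreducible.
    exact: weakly_directed_nil.
  exact: weakly_directed_cat.
have unitF : 1 + t * B \is a GRing.unit.
  by rewrite unit_fpsE fcoefD fcoefM big_ord1 mul0r addr0.
have -> : (2 * t * B) / (1 + t * B) = 2 * I.
  by rewrite -(mulrA 2) {1}(addrI _ eqF) mulrA mulrK.
rewrite div1r; apply/esym/mulr1_eq.
have -> : (1 + t - 2 * I) * W = W - (2 * I - t) * W by ring.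
by rewrite {1}eqW addrK.
Qed.
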